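(* Let $d,n_S\ge 1$, $\sigma>0$, $r>0$, and let $X_S\in\mathbb{R}^{n_S\times d}$ be a fixed matrix such that $\hat\Sigma_S:=X_S^\top X_S/n_S$ is invertible. Observations are $\mathbf{y}_S=X_S\boldsymbol{\beta}^*+\mathbf{z}$ with $\mathbf{z}\sim\mathcal{N}(0,\sigma^2 I_{n_S})$ and unknown $\boldsymbol{\beta}^*\in\mathcal{B}:=\{\boldsymbol{\beta}\in\mathbb{R}^d:\|\boldsymbol{\beta}\|_2\le r\}$. Let $\Sigma_T\in\mathbb{R}^{d\times d}$ be positive definite, and suppose there is an orthogonal matrix $U$ and vectors $\mathbf{t},\mathbf{s}\in(0,\infty)^d$ with $\Sigma_T=U\operatorname{diag}(\mathbf{t})U^\top$ and $\hat\Sigma_S=U\operatorname{diag}(\mathbf{s})U^\top$. Define the minimax linear risk $$R_L(\mathcal{B}):=\min_{A\in\mathbb{R}^{d\times n_S}}\ \max_{\boldsymbol{\beta}^*\in\mathcal{B}}\ \mathbb{E}_{\mathbf{z}}\big\|\Sigma_T^{1/2}(A\mathbf{y}_S-\boldsymbol{\beta}^* )\big\|_2^2 .$$ Let $\lambda=\lambda(r)>0$ be determined by $\frac{\sigma^2}{n_S}\sum_{i=1}^d \frac{1}{s_i}\big(\sqrt{t_i}/\lambda-1\big)_+=r^2$. Then $$R_L(\mathcal{B})=\sum_{i=1}^d\frac{\sigma^2}{n_S}\frac{t_i}{s_i}\Big(1-\frac{\lambda}{\sqrt{t_i}}\Big)_+ ,$$ and this value is attained by the linear estimator $$\hat{\boldsymbol{\beta}}_{\mathrm{MM}}=\Sigma_T^{-1/2}U\big(I-\operatorname{diag}(\lambda/\sqrt{\mathbf{t}})\big)_+U^\top\Sigma_T^{1/2}\,\hat{\boldsymbol{\beta}}_{\mathrm{SS}},\qquad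 \hat{\boldsymbol{\beta}}_{\mathrm{SS}}:=\frac{1}{n_S}\hat\Sigma_S^{-1}X_S^\top\mathbf{y}_S,$$ where $\operatorname{diag}(\lambda/\sqrt{\mathbf{t}})$ is the diagonal matrix with entries $\lambda/\sqrt{t_i}$ and $(\cdot)_+$ is applied entrywise to the diagonal.
   Context: $(x)_+=\max(x,0)$. An estimator is called linear if it has the form $\mathbf{y}_S\mapsto A\mathbf{y}_S$ for a matrix $A$ that may depend on $X_S$, $n_S$, $\Sigma_T$ but not on $\mathbf{y}_S$. The expectation is over the noise $\mathbf{z}$ only; $X_S$ is treated as fixed. *)

(* Defs.v *)
From HB Require Import structures.
From mathcomp Require Import all_boot all_order all_algebra.
From mathcomp Require Import all_classical all_reals all_analysis.
Set Implicit Arguments. Unset Strict Implicit. Unset Printing Implicit Defensive.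
Import Order.TTheory GRing.Theory Num.Theory.
Local Open Scope ring_scope.

Section Defs.
Context {R : realType}.

Definition pos (x : R) : R := Num.max x 0.

Definition sumsq {n} (v : 'cV[R]_n) : R := \sum_(i < n) v i 0 ^+ 2.
Definition l2norm {n} (v : 'cV[R]_n) : R := Num.sqrt (sumsq v).

(* Expectation of f(z) for z ~ N(0, sigma^2 I_n), written as the iterated
   integral over the n independent N(0, sigma^2) coordinates
   (normal_prob m s has mean m and standard deviation s). *)
Fixpoint gauss_expect (sigma : R) (n : nat) : ('cV[R]_n -> \bar R) -> \bar R :=
  match n with
  | 0 => fun f => f 0
  | m.+1 => fun f =>
      (\int[normal_prob 0 sigma]_x
          gauss_expect sigma (fun z : 'cV[R]_m => f (col_mx (x%:M : 'M[R]_1) z)))%E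
  end.

Definition lin_risk {d n} (sigma : R) (XS : 'M[R]_(n, d)) (ST12 : 'M[R]_d)
  (A : 'M[R]_(d, n)) (beta : 'cV[R]_d) : \bar R :=
  gauss_expect sigma
    (fun z : 'cV[R]_n => ((l2norm (ST12 *m (A *m (XS *m beta + z) - beta))) ^+ 2)%:E).

Definition max_risk {d n} (sigma r : R) (XS : 'M[R]_(n, d)) (ST12 : 'M[R]_d)
  (A : 'M[R]_(d, n)) : \bar R :=
  ereal_sup [set lin_risk sigma XS ST12 A b | b in [set b : 'cV[R]_d | l2norm b <= r]].

End Defs.

(* Main.v *)
Require Import Defs.
From HB Require Import structures.
From mathcomp Require Import all_boot all_order all_algebra.
From mathcomp Require Import all_classical all_reals all_analysis.
From mathcomp Require Import measurable_realfun ring lra.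
Set Implicit Arguments.
Unset Strict Implicit.
Import Order.TTheory GRing.Theory Num.Theory.
Import numFieldNormedType.Exports.
Local Open Scope ring_scope.

(** Let [S] be the square root of the target covariance, with eigenvalues
    [e_i] in the common eigenbasis [u_i], and let [g_i] be the eigenvalues of
    [X^T X].  The risk of [A] at [beta] is the squared bias
    [|(S A X - S) beta|^2] plus the variance [sigma^2 |S A|_F^2].

    Lower bound: average the risk over the [d] points [r u_i] with weights
    [tau_i^2 / r^2], where [tau_i^2 = sigma^2 / g_i (e_i / lambda - 1)_+]; the
    choice of [lambda] makes them sum to one.  The vectors [X u_i] are
    orthogonal, so Bessel's inequality bounds the variance from below by the
    diagonal entries [w_i] of [S A X] in the basis [u_i] alone, and [d]
    independent scalar quadratics remain, each minimized at
    [w_i = (e_i - lambda)_+].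

    Upper bound: the stated estimator has exactly these [w_i], and its bias
    along [u_i] is [e_i - w_i = min(e_i, lambda) <= lambda]. *)

Section DensityChangeOfVariables.
Local Open Scope ereal_scope.
Context d (T : measurableType d) (R : realType).
Variables (nu : {finite_measure set T -> \bar R})
          (mu : {sigma_finite_measure set T -> \bar R}) (p f : T -> \bar R).

Lemma ge0_integral_density :
  measurable_fun [set: T] p ->
  (forall A, measurable A -> nu A = \int[mu]_(x in A) p x) ->
  (forall x, 0 <= f x) -> measurable_fun [set: T] f ->
  \int[nu]_x f x = \int[mu]_x (f x * p x).
Proof.
move=> mp nuE f0 mf.
have numu : nu `<< mu.
  apply/null_content_dominatesP => A mA muA0; rewrite nuE//.
  by apply: null_set_integral => //; exact: measurable_funTS.
rewrite -(Radon_Nikodym_SigmaFinite.change_of_variables numu)//.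
have intRN := Radon_Nikodym_SigmaFinite.f_integrable numu.
apply: ae_eq_integral => //.
- by apply: emeasurable_funM => //; exact: measurable_int intRN.
- exact: emeasurable_funM.
- apply: ae_eqe_mul2l; apply: integral_ae_eq => //= A _ mA.
  by rewrite -nuE// -Radon_Nikodym_SigmaFinite.f_integral.
Qed.

End DensityChangeOfVariables.

Section NormalMoments.
Local Open Scope classical_set_scope.
Context {R : realType}.
Notation mu := (@lebesgue_measure R).
Implicit Types (m s a b c x y : R).

Lemma ge0_integral_normal_prob m s (f : R -> \bar R) :
  (forall x, 0 <= f x)%E -> measurable_fun [set: R] f ->
  (\int[normal_prob m s]_x f x = \int[mu]_x (f x * (normal_pdf m s x)%:E))%E.
Proof.
move=> f0 mf.
apply: ge0_integral_density => //.
by apply/measurable_EFinP; exact: measurable_normal_pdf.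
Qed.

Lemma ge0_cvgn_integral_itv m (f : R -> R) :
  (forall x, 0 <= f x) -> measurable_fun [set: R] f ->
  (\int[mu]_(x in `[(m - n%:R)%R, (m + n%:R)%R]) (f x)%:E)%E @[n --> \oo] -->
  (\int[mu]_x (f x)%:E)%E.
Proof.
move=> f0 mf; pose F n : set R := `[(m - n%:R), (m + n%:R)].
have <- : \bigcup_n F n = [set: R].
  rewrite -subTset => x _; exists (Num.bound `|x - m|) => //=.
  by rewrite /F/= in_itv/= -ler_distl ltW// archi_boundP.
apply: ge0_nondecreasing_set_cvg_integral => //.
- move=> n k nk; apply/subsetPset.
  by apply: subset_itvScc; rewrite bnd_simp lerD2l ?lerN2 ler_nat.
- by move=> n; apply/measurable_EFinP/measurable_funTS.
- by move=> n x _; rewrite lee_fin.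
Qed.

Lemma normal_pdf_sym m s y : s != 0 ->
  normal_pdf m s (m - y) = normal_pdf m s (m + y).
Proof.
move=> s0; rewrite !normal_pdfE// /normal_fun.
by rewrite (addrAC m y) (addrAC m (- y)) subrr !add0r sqrrN.
Qed.

Lemma continuous_quadratic a b c :
  continuous (fun x : R => a * x ^+ 2 + b * x + c).
Proof.
move=> x; apply: cvgD; last exact: cvg_cst.
by apply: cvgD; apply: cvgMr; [exact: exprn_continuous|exact: cvg_id].
Qed.

Lemma is_derive_normal_pdf m s x : s != 0 ->
  is_derive x 1 (normal_pdf m s) (- ((x - m) / s ^+ 2) * normal_pdf m s x).
Proof.
move=> s0; rewrite normal_pdfE//.
have -> : (fun y => normal_peak s * normal_fun m s y) =
  (fun y => normal_peak s * expR (- ((y - m) ^+ 2 / (s ^+ 2 *+ 2)))).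
  by apply/funext => y; rewrite /normal_fun mulNr.
apply: is_derive_eq.
rewrite /GRing.scale/= /normal_fun (mulNr ((x - m) ^+ 2)); set e := expR _.
by field; rewrite s0.
Qed.

Lemma mulr_normal_pdf_le m s y : s != 0 -> 0 < y ->
  y * normal_pdf m s (m + y) <= normal_peak s * (s ^+ 2 *+ 2) / y.
Proof.
move=> s0 y0; rewrite normal_pdfE// /normal_fun addrAC subrr add0r mulNr expRN.
have s20 : 0 < s ^+ 2 *+ 2 by rewrite pmulrn_lgt0// exprn_even_gt0.
set z := y ^+ 2 / _.
have z0 : 0 < z by rewrite divr_gt0// exprn_gt0.
rewrite mulrCA -!mulrA ler_wpM2l ?normal_peak_ge0//.
have -> : s ^+ 2 *+ 2 / y = y / z by rewrite /z; field; rewrite s0 !gt_eqF.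
rewrite ler_wpM2l ?(ltW y0)// lef_pV2 ?posrE ?expR_gt0//.
by rewrite (le_trans _ (expR_ge1Dx z))// lerDr.
Qed.

Lemma cvg_mulr_normal_pdf m s : s != 0 ->
  n%:R * normal_pdf m s (m + n%:R) @[n --> \oo] --> (0 : R).
Proof.
move=> s0; rewrite -cvg_shiftS/=; pose K := normal_peak s * (s ^+ 2 *+ 2).
apply: (@squeeze_cvgr _ _ _ _ (cst 0) (fun n => K * n.+1%:R^-1)).
- apply: nearW => n; rewrite mulr_ge0 ?ler0n ?normal_pdf_ge0//=.
  exact: mulr_normal_pdf_le.
- exact: cvg_cst.
- by rewrite -[X in _ --> X](mulr0 K); apply: cvgMr; exact: cvg_harmonic.
Qed.

(* The quadratic minus its mean, times the density, is the derivative of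
   [- s ^ 2 (a x + a m + b)] times the density. *)
Lemma integral_quadratic_normal_pdf_itv m s a b c y : s != 0 -> 0 < y ->
  (\int[mu]_(x in `[(m - y)%R, (m + y)%R])
      ((a * x ^+ 2 + b * x + c) * normal_pdf m s x)%:E =
   (a * (m ^+ 2 + s ^+ 2) + b * m + c)%:E *
     \int[mu]_(x in `[(m - y)%R, (m + y)%R]) (normal_pdf m s x)%:E
   - (2 * a * s ^+ 2 * (y * normal_pdf m s (m + y)))%:E)%E.
Proof.
move=> s0 y0; set phi := normal_pdf m s; set mean := a * (_ + _) + _ + _.
pose q x := a * x ^+ 2 + b * x + c.
pose H x := - s ^+ 2 * (a * x + a * m + b) * phi x.
have cphi : continuous phi by exact: continuous_normal_pdf.
have cq_phi : continuous (fun x => (q x - mean) * phi x).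
  move=> x; apply: cvgM; last exact: cphi.
  by apply: cvgB; [exact: continuous_quadratic|exact: cvg_cst].
have dH x : is_derive x 1 H ((q x - mean) * phi x).
  have dphi := is_derive_normal_pdf m x s0.
  apply: is_derive_eq; rewrite /GRing.scale/= -/phi /q /mean; field.
  by rewrite s0.
have cH : continuous H.
  by move=> x; apply/differentiable_continuous/derivable1_diffP/ex_derive.
have int_itv (f : R -> R) : continuous f ->
    mu.-integrable `[(m - y)%R, (m + y)%R] (EFin \o f).
  move=> cf; apply: continuous_compact_integrable; first exact: segment_compact.
  exact: continuous_subspaceT.
transitivity (\int[mu]_(x in `[(m - y)%R, (m + y)%R])
    (mean%:E * (phi x)%:E + ((q x - mean) * phi x)%:E))%E.
  by apply: eq_integral => x _; rewrite -EFinD; congr EFin; rewrite /q; ring.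
have int_phi := int_itv _ cphi.
rewrite integralD//; [|exact: integrableZl|exact: int_itv].
rewrite integralZl//; congr (_ + _)%E.
rewrite (@continuous_FTC2 _ _ H)//.
- rewrite -EFinB -EFinN; congr EFin.
  by rewrite /H /phi normal_pdf_sym//; ring.
- by lra.
- exact: continuous_subspaceT.
- by split=> //; [apply: cvg_at_right_filter|apply: cvg_at_left_filter];
    exact: cH.
- by move=> x _; rewrite derive1E derive_val.
Qed.

Lemma ge0_normal_prob_integral_quadratic m s a b c : s != 0 ->
  (forall x, 0 <= a * x ^+ 2 + b * x + c) ->
  (\int[normal_prob m s]_x (a * x ^+ 2 + b * x + c)%:E =
   (a * (m ^+ 2 + s ^+ 2) + b * m + c)%:E)%E.
Proof.
move=> s0 q0; pose q x := a * x ^+ 2 + b * x + c; set mean := a * _ + _ + _.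
have mq : measurable_fun [set: R] q.
  by apply: continuous_measurable_fun; exact: continuous_quadratic.
set phi := normal_pdf m s.
have phi0 x : 0 <= phi x by exact: normal_pdf_ge0.
have mphi : measurable_fun [set: R] phi by exact: measurable_normal_pdf.
rewrite ge0_integral_normal_prob//; last exact/measurable_EFinP.
under eq_integral do rewrite -EFinM.
have cvg_qphi := ge0_cvgn_integral_itv m (fun x => mulr_ge0 (q0 x) (phi0 x))
  (measurable_funM mq mphi).
have cvg_phi := ge0_cvgn_integral_itv m phi0 mphi.
have cvg_tail : (2 * a * s ^+ 2 * (n%:R * phi (m + n%:R)))%:E @[n --> \oo]
    --> 0%E.
  rewrite -[0%E]/(0%:E) -(mulr0 (2 * a * s ^+ 2)); apply: cvg_EFin.
    exact: nearW.
  by apply: cvgMr; exact: cvg_mulr_normal_pdf.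
rewrite integral_normal_pdf in cvg_phi.
have := cvgeZl (y := mean%:E) isT cvg_phi; rewrite mule1 => cvg_mean.
have := cvgeB (a := mean%:E) (b := 0%E) isT cvg_mean cvg_tail.
rewrite sube0 => cvg_rhs.
rewrite -cvg_shiftS in cvg_qphi; rewrite -cvg_shiftS in cvg_rhs.
apply: (cvg_unique _ cvg_qphi) => //; rewrite (funext (fun n : nat =>
  integral_quadratic_normal_pdf_itv m a b c s0 (ltr0Sn R n))).
exact: cvg_rhs.
Qed.

End NormalMoments.

Lemma col_mul (R : pzSemiRingType) m n p (j : 'I_p) (A : 'M[R]_(m, n))
    (B : 'M[R]_(n, p)) :
  col j (A *m B) = A *m col j B.
Proof. by rewrite !colE mulmxA. Qed.

Section SpectralMatrix.
Variables (F : fieldType) (d : nat) (U : 'M[F]_d).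
Implicit Types (a b : 'rV[F]_d) (x : 'cV[F]_d) (k : F).

Definition spectral_mx a : 'M[F]_d := U *m diag_mx a *m U^T.

Lemma tr_spectral_mx a : (spectral_mx a)^T = spectral_mx a.
Proof. by rewrite /spectral_mx !trmx_mul trmxK tr_diag_mx mulmxA. Qed.

Lemma spectral_mxZ k a : k *: spectral_mx a = spectral_mx (k *: a).
Proof.
by rewrite /spectral_mx scalemxAl scalemxAr [diag_mx (k *: a)]linearZ.
Qed.

Lemma spectral_mxB a b : spectral_mx a - spectral_mx b = spectral_mx (a - b).
Proof. by rewrite -mulmxBl -mulmxBr -raddfB. Qed.

Lemma quadratic_form_spectral_mx a x :
  (x^T *m spectral_mx a *m x) 0 0 = \sum_i a 0 i * (U^T *m x) i 0 ^+ 2.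
Proof.
have -> : x^T *m spectral_mx a *m x =
    (U^T *m x)^T *m diag_mx a *m (U^T *m x).
  by rewrite trmx_mul trmxK !mulmxA.
rewrite mxE; apply: eq_bigr => i _.
by rewrite mul_mx_diag !mxE mulrAC mulrC expr2.
Qed.

Hypothesis UtU : U^T *m U = 1%:M.

Lemma mul_spectral_mx a b :
  spectral_mx a *m spectral_mx b = spectral_mx (\row_i (a 0 i * b 0 i)).
Proof.
rewrite /spectral_mx !mulmxA -(mulmxA _ U^T) UtU mulmx1.
by rewrite -(mulmxA _ (diag_mx a)) mulmx_diag.
Qed.

Lemma spectral_mxC a b :
  spectral_mx a *m spectral_mx b = spectral_mx b *m spectral_mx a.
Proof.
rewrite !mul_spectral_mx; congr spectral_mx; apply/rowP => i.
by rewrite !mxE mulrC.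
Qed.

Lemma spectral_mx_cst k : spectral_mx (const_mx k) = k%:M.
Proof.
rewrite /spectral_mx diag_const_mx mul_mx_scalar -scalemxAl mulmx1C//.
by rewrite scalemx1.
Qed.

Lemma mul_spectral_mxV a : (forall i, a 0 i != 0) ->
  spectral_mx a *m spectral_mx (\row_i (a 0 i)^-1) = 1%:M.
Proof.
move=> a0; rewrite mul_spectral_mx -(spectral_mx_cst 1); congr spectral_mx.
by apply/rowP => i; rewrite !mxE mulfV.
Qed.

Lemma unitmx_spectral a : (forall i, a 0 i != 0) -> spectral_mx a \in unitmx.
Proof. by move=> /mul_spectral_mxV /mulmx1_unit[]. Qed.

Lemma invmx_spectral a : (forall i, a 0 i != 0) ->
  invmx (spectral_mx a) = spectral_mx (\row_i (a 0 i)^-1).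
Proof.
move=> a0; rewrite -[LHS]mulmx1 -(mul_spectral_mxV a0).
by rewrite mulKmx// unitmx_spectral.
Qed.

Lemma invmx_conj_spectral a b : (forall i, a 0 i != 0) ->
  invmx (spectral_mx a) *m U *m diag_mx b *m U^T *m spectral_mx a =
  spectral_mx b.
Proof.
move=> a0; rewrite -(mulmxA _ U) -(mulmxA _ (U *m _)) -/(spectral_mx b).
by rewrite -mulmxA spectral_mxC mulKmx// unitmx_spectral.
Qed.

Lemma mxtrace_spectral a : \tr (spectral_mx a) = \sum_i a 0 i.
Proof.
by rewrite /spectral_mx mxtrace_mulC mulmxA UtU mul1mx mxtrace_diag.
Qed.

Lemma conj_spectral_mx a : U^T *m spectral_mx a *m U = diag_mx a.
Proof.
by rewrite /spectral_mx !mulmxA UtU mul1mx -mulmxA UtU mulmx1.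
Qed.

End SpectralMatrix.

Section PositiveMatrices.
Context {R : realFieldType} {d : nat}.
Implicit Types A B M : 'M[R]_d.

Definition psdmx A := forall x : 'cV[R]_d, 0 <= (x^T *m A *m x) 0 0.

Definition posdefmx A :=
  forall x : 'cV[R]_d, x != 0 -> 0 < (x^T *m A *m x) 0 0.

Lemma psdmx_posdefmxD A B : psdmx A -> posdefmx B -> posdefmx (A + B).
Proof.
move=> A0 B0 x x0; rewrite mulmxDr mulmxDl mxE.
by rewrite ltr_wpDl// B0.
Qed.

Lemma posdefmx_psdmx A : posdefmx A -> psdmx A.
Proof.
move=> A0 x; have [->|/A0/ltW//] := eqVneq x 0.
by rewrite mulmx0 mxE.
Qed.

Lemma posdefmx_mxtrace_eq0 n M (D : 'M[R]_(d, n)) :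
  posdefmx M -> \tr (D^T *m M *m D) = 0 -> D = 0.
Proof.
move=> M0.
have -> : \tr (D^T *m M *m D) = \sum_j ((col j D)^T *m M *m col j D) 0 0.
  by apply: eq_bigr => j _; rewrite tr_col -!row_mul -col_mul !mxE.
move=> /eqP; rewrite psumr_eq0 => [/allP /= trD0|j _]; last first.
  exact: posdefmx_psdmx.
apply/matrixP => i j; have := trD0 j (mem_index_enum j).
have [/colP/(_ i)|/M0/gt_eqF->//] := eqVneq (col j D) 0.
by rewrite !mxE.
Qed.

(* Since [A ^ 2 = B ^ 2], [D = A - B] satisfies [(A + B) D + D (A + B) = 0];
   the trace against [D] is then twice the quadratic form of [A + B] on [D]. *)
Lemma psdmx_sqrt_uniq A B : A^T = A -> B^T = B -> psdmx A -> posdefmx B ->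
  A *m A = B *m B -> A = B.
Proof.
move=> AT BT A0 B0 AABB; pose M := A + B; pose D := A - B.
have DT : D^T = D by rewrite /D linearB/= AT BT.
have lyapunov : M *m D = - (D *m M).
  rewrite /M /D !mulmxDl !mulmxDr !mulmxN !mulNmx AABB !opprD !opprK.
  by rewrite [LHS]addrC [RHS]addrC !addrA subrK addrK.
apply/eqP; rewrite -subr_eq0 -/D; apply/eqP.
apply: (posdefmx_mxtrace_eq0 (psdmx_posdefmxD A0 B0)); rewrite DT -/M.
have : \tr (D *m M *m D) = - \tr (D *m M *m D).
  by rewrite -{1}mulmxA lyapunov mulmxN linearN/= mxtrace_mulC.
lra.
Qed.

End PositiveMatrices.

Section SquaredFrobeniusNorm.
Context {R : realDomainType}.

Definition frobsq m n (B : 'M[R]_(m, n)) : R := \tr (B *m B^T).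

Lemma frobsqE m n (B : 'M[R]_(m, n)) : frobsq B = \sum_i \sum_j B i j ^+ 2.
Proof.
apply: eq_bigr => i _; rewrite mxE; apply: eq_bigr => j _.
by rewrite mxE expr2.
Qed.

Lemma frobsq_ge0 m n (B : 'M[R]_(m, n)) : 0 <= frobsq B.
Proof. by rewrite frobsqE; do 2 apply: sumr_ge0 => ? _; exact: sqr_ge0. Qed.

Lemma frobsq_row_mx m n1 n2 (A : 'M[R]_(m, n1)) (B : 'M[R]_(m, n2)) :
  frobsq (row_mx A B) = frobsq A + frobsq B.
Proof. by rewrite /frobsq tr_row_mx mul_row_col mxtraceD. Qed.

Section OrthogonalProjection.
Context {m n : nat} (G : 'M[R]_(m, n)) (P : 'M[R]_n).
Hypotheses (PT : P^T = P) (PP : P *m P = P).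

Lemma frobsq_mul_proj : frobsq (G *m P) = \tr (G *m P *m G^T).
Proof. by rewrite /frobsq trmx_mul PT mulmxA -(mulmxA G) PP. Qed.

Lemma frobsq_mul_proj_le : frobsq (G *m P) <= frobsq G.
Proof.
rewrite -subr_ge0; have := frobsq_ge0 (G - G *m P).
rewrite frobsq_mul_proj /frobsq [(_ - _)^T]raddfB/= trmx_mul PT mulmxBl.
rewrite !mulmxBr !(mulmxA (G *m P)) mulmxA -(mulmxA G P P) PP subrr subr0.
by rewrite raddfB.
Qed.

End OrthogonalProjection.

End SquaredFrobeniusNorm.

Section SumSquares.
Context {R : realType}.

Lemma sumsq_ge0 n (v : 'cV[R]_n) : 0 <= sumsq v.
Proof. by apply: sumr_ge0 => i _; rewrite sqr_ge0. Qed.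

Lemma sqr_coord_le_sumsq n (v : 'cV[R]_n) i : v i 0 ^+ 2 <= sumsq v.
Proof.
by rewrite /sumsq (bigD1 i)//= lerDl sumr_ge0// => j _; rewrite sqr_ge0.
Qed.

Lemma l2norm_sqr n (v : 'cV[R]_n) : l2norm v ^+ 2 = sumsq v.
Proof. by rewrite sqr_sqrtr ?sumsq_ge0. Qed.

Lemma l2norm_le n (v : 'cV[R]_n) (r : R) : 0 <= r ->
  (l2norm v <= r) = (sumsq v <= r ^+ 2).
Proof.
move=> r0; rewrite -(ler_pXn2r (n := 2)) ?nnegrE ?sqrtr_ge0//.
by rewrite l2norm_sqr.
Qed.

Lemma sumsqE n (v : 'cV[R]_n) : sumsq v = (v^T *m v) 0 0.
Proof. by rewrite mxE; apply: eq_bigr => i _; rewrite mxE expr2. Qed.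

Lemma sumsq_col m n (B : 'M[R]_(m, n)) i : sumsq (col i B) = (B^T *m B) i i.
Proof. by rewrite mxE; apply: eq_bigr => j _; rewrite !mxE expr2. Qed.

Lemma sumsq_isometry m n (U : 'M[R]_(m, n)) (v : 'cV[R]_n) :
  U^T *m U = 1%:M -> sumsq (U *m v) = sumsq v.
Proof.
by move=> UU; rewrite !sumsqE trmx_mul mulmxA -(mulmxA v^T) UU mulmx1.
Qed.

Lemma sumsqZ n (k : R) (v : 'cV[R]_n) : sumsq (k *: v) = k ^+ 2 * sumsq v.
Proof.
by rewrite /sumsq mulr_sumr; apply: eq_bigr => i _; rewrite mxE exprMn.
Qed.

Lemma sumsq_addZ n (u b : 'cV[R]_n) (x : R) :
  sumsq (u + x *: b) =
  sumsq b * x ^+ 2 + (2 * \sum_i u i 0 * b i 0) * x + sumsq u.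
Proof.
rewrite /sumsq mulr_suml mulr_sumr mulr_suml -!big_split/=.
by apply: eq_bigr => i _; rewrite !mxE; ring.
Qed.

Lemma frobsq_cV m (b : 'cV[R]_m) : frobsq b = sumsq b.
Proof. by rewrite frobsqE; apply: eq_bigr => i _; rewrite big_ord1. Qed.

Lemma bessel_mx m n d (G : 'M[R]_(m, n)) (Y : 'M[R]_(n, d)) (g : 'rV[R]_d) :
  (forall i, 0 < g 0 i) -> Y^T *m Y = diag_mx g ->
  \sum_i sumsq (G *m col i Y) / g 0 i <= frobsq G.
Proof.
move=> g0 YY; pose D := diag_mx (\row_i (g 0 i)^-1).
have DK : D *m diag_mx g = 1%:M.
  rewrite mulmx_diag -diag_const_mx; congr diag_mx; apply/rowP => i.
  by rewrite !mxE mulVf// gt_eqF.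
(* [P] is the orthogonal projection onto the column space of [Y]. *)
pose P := Y *m D *m Y^T.
have PT : P^T = P by rewrite /P !trmx_mul trmxK tr_diag_mx mulmxA.
have PP : P *m P = P.
  by rewrite /P -!mulmxA (mulmxA Y^T) YY (mulmxA D (diag_mx g)) DK mul1mx.
rewrite (_ : \sum_i _ = frobsq (G *m P)) ?frobsq_mul_proj_le//.
rewrite frobsq_mul_proj// /P !mulmxA -(mulmxA _ Y^T) -trmx_mul.
rewrite mxtrace_mulC mulmxA; apply: eq_bigr => i _.
by rewrite mul_mx_diag -col_mul sumsq_col [RHS]mxE [X in _ = _ * X]mxE.
Qed.

End SumSquares.

Section RotatedCoordinates.
Context {R : realType} {d : nat} (U : 'M[R]_d).
Hypothesis UtU : U^T *m U = 1%:M.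

Lemma sumsq_rotate (v : 'cV[R]_d) : sumsq (U^T *m v) = sumsq v.
Proof. by rewrite sumsq_isometry// trmxK mulmx1C. Qed.

Lemma sumsq_col_orthogonal i : sumsq (col i U) = 1.
Proof. by rewrite sumsq_col UtU mxE eqxx. Qed.

Lemma sqr_conj_diag_le_sumsq (M : 'M[R]_d) i :
  (U^T *m M *m U) i i ^+ 2 <= sumsq (M *m col i U).
Proof.
rewrite -sumsq_rotate; apply: le_trans (sqr_coord_le_sumsq _ i).
by rewrite mulmxA -col_mul [col _ _ _ _]mxE.
Qed.

Lemma sumsq_spectral_mx a (v : 'cV[R]_d) :
  sumsq (spectral_mx U a *m v) = \sum_i a 0 i ^+ 2 * (U^T *m v) i 0 ^+ 2.
Proof.
rewrite sumsqE trmx_mul tr_spectral_mx mulmxA -(mulmxA v^T).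
rewrite mul_spectral_mx// quadratic_form_spectral_mx.
by apply: eq_bigr => i _; rewrite mxE -expr2.
Qed.

Lemma posdefmx_spectral (a : 'rV[R]_d) : (forall i, 0 < a 0 i) ->
  posdefmx (spectral_mx U a).
Proof.
move=> a0 x x0; rewrite quadratic_form_spectral_mx lt0r.
have ax i : 0 <= a 0 i * (U^T *m x) i 0 ^+ 2 by rewrite mulr_ge0 ?sqr_ge0// ltW.
rewrite sumr_ge0// andbT psumr_eq0//; apply: contra x0 => /allP /= ax0.
have Ux0 : U^T *m x = 0.
  apply/colP => i; have := ax0 i (mem_index_enum i).
  by rewrite mulf_eq0 gt_eqF//= sqrf_eq0 [RHS]mxE => /eqP.
by rewrite -[x]mul1mx -(mulmx1C UtU) -mulmxA Ux0 mulmx0.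
Qed.

Lemma psdmx_sqrt_spectral (S : 'M[R]_d) (t : 'rV[R]_d) :
  (forall i, 0 < t 0 i) -> S^T = S -> psdmx S -> S *m S = spectral_mx U t ->
  S = spectral_mx U (\row_i Num.sqrt (t 0 i)).
Proof.
move=> t0 ST S0 SS; apply: psdmx_sqrt_uniq => //; first exact: tr_spectral_mx.
  by apply: posdefmx_spectral => i; rewrite mxE sqrtr_gt0.
rewrite SS mul_spectral_mx//; congr spectral_mx; apply/rowP => i.
by rewrite !mxE -expr2 sqr_sqrtr// ltW.
Qed.

End RotatedCoordinates.

Section LinearRisk.
Context {R : realType}.

Lemma gauss_expect_sumsq (s : R) m n (u : 'cV[R]_m) (B : 'M[R]_(m, n)) :
  s != 0 ->
  gauss_expect s (fun z => (sumsq (u + B *m z))%:E) =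
  (sumsq u + s ^+ 2 * frobsq B)%:E.
Proof.
move=> s0; elim: n u B => [|n IHn] u B.
  by rewrite /= mulmx0 addr0 /frobsq (thinmx0 B) mul0mx mxtrace0 mulr0 addr0.
pose b : 'cV[R]_m := lsubmx (B : 'M[R]_(m, 1 + n)).
pose B' : 'M[R]_(m, n) := rsubmx (B : 'M[R]_(m, 1 + n)).
have BE : row_mx b B' = B by rewrite hsubmxK.
have frobB : frobsq B = sumsq b + frobsq B'.
  by rewrite -frobsq_cV -frobsq_row_mx BE.
pose c := sumsq u + s ^+ 2 * frobsq B'.
have conditional x : gauss_expect s
    (fun z : 'cV[R]_n => (sumsq (u + B *m col_mx (x%:M : 'M[R]_1) z))%:E) =
    (sumsq b * x ^+ 2 + (2 * \sum_i u i 0 * b i 0) * x + c)%:E.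
  rewrite /c addrA -sumsq_addZ -IHn; congr gauss_expect; apply/funext => z.
  by rewrite -addrA -mul_mx_scalar -mul_row_col BE.
rewrite /=; under eq_integral do rewrite conditional.
rewrite ge0_normal_prob_integral_quadratic// => [|x].
  by congr EFin; rewrite frobB /c; ring.
rewrite /c addrA -sumsq_addZ addr_ge0 ?sumsq_ge0//.
by rewrite mulr_ge0 ?sqr_ge0 ?frobsq_ge0.
Qed.

Lemma lin_riskE (s : R) d n (X : 'M[R]_(n, d)) (S : 'M[R]_d)
    (A : 'M[R]_(d, n)) (beta : 'cV[R]_d) : s != 0 ->
  lin_risk s X S A beta =
  (sumsq ((S *m A *m X - S) *m beta) + s ^+ 2 * frobsq (S *m A))%:E.
Proof.
move=> s0; rewrite -gauss_expect_sumsq//; congr gauss_expect.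
apply/funext => z; rewrite l2norm_sqr; congr (sumsq _)%:E.
by rewrite mulmxBr mulmxBl !mulmxDr !mulmxA addrAC.
Qed.

End LinearRisk.

Lemma convex_combination_lee (R : realDomainType) (I : finType) (w a : I -> R)
    (M : \bar R) :
  (forall i, 0 <= w i) -> \sum_i w i = 1 -> (forall i, (a i)%:E <= M)%E ->
  ((\sum_i w i * a i)%:E <= M)%E.
Proof.
move=> w0 w1; case: M => [M| |] aM; last 2 first.
- by rewrite leey.
- have [i _|I0] := pickP (predT : pred I); first by have := aM i.
  by move: w1; rewrite big_pred0// => /esym/eqP; rewrite oner_eq0.
rewrite lee_fin -[leRHS]mul1r -w1 mulr_suml ler_sum// => i _.
by rewrite ler_wpM2l// -lee_fin.
Qed.

Section PositivePart.
Context {R : realType}.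
Implicit Types (k x e w lam : R).

Lemma posP x : (0 <= x /\ pos x = x) \/ (x <= 0 /\ pos x = 0).
Proof.
by rewrite /pos; have [x0|/ltW x0] := leP x 0; [right|left].
Qed.

Lemma pos_ge0 x : 0 <= pos x.
Proof. by have [[x0 ->]|[_ ->]] := posP x. Qed.

Lemma posM k x : 0 <= k -> pos (k * x) = k * pos x.
Proof. by move=> k0; rewrite /pos maxr_pMr// mulr0. Qed.

Lemma sqr_pos x : pos x ^+ 2 = x * pos x.
Proof. by have [[_ ->]|[_ ->]] := posP x; rewrite ?expr2 ?mulr0. Qed.

Lemma mul_pos_divB1 lam e : 0 < lam -> lam * pos (e / lam - 1) = pos (e - lam).
Proof.
by move=> lam0; rewrite -posM ?ltW//; congr pos; field; rewrite gt_eqF.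
Qed.

Lemma mul_pos_1Bdiv lam e : 0 < e -> e * pos (1 - lam / e) = pos (e - lam).
Proof.
by move=> e0; rewrite -posM ?ltW//; congr pos; field; rewrite gt_eqF.
Qed.

Lemma sqr_pos_subr_le lam e : 0 <= lam -> 0 <= e ->
  (pos (e - lam) - e) ^+ 2 <= lam ^+ 2.
Proof.
move=> lam0 e0; rewrite -sqrrN ler_pXn2r ?nnegrE//.
  by have [[le ->]|[el ->]] := posP (e - lam); lra.
by have [[le ->]|[el ->]] := posP (e - lam); lra.
Qed.

Lemma soft_threshold_min lam e w : 0 < lam ->
  e * pos (e - lam) <= pos (e / lam - 1) * (w - e) ^+ 2 + w ^+ 2.
Proof.
move=> lam0; rewrite -(mul_pos_divB1 e lam0).
have [[le ->]|[_ ->]] := posP (e / lam - 1); last first.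
  by rewrite !mulr0 mul0r add0r sqr_ge0.
rewrite -subr_ge0.
have -> : (e / lam - 1) * (w - e) ^+ 2 + w ^+ 2 - e * (lam * (e / lam - 1)) =
  e / lam * (w - (e - lam)) ^+ 2 by field; rewrite gt_eqF.
by rewrite mulr_ge0 ?sqr_ge0//; lra.
Qed.

Lemma soft_threshold_balance lam e :
  lam * pos (e - lam) + pos (e - lam) ^+ 2 = e * pos (e - lam).
Proof. by rewrite sqr_pos; ring. Qed.

End PositivePart.

Section OrdinaryLeastSquares.
Context {F : fieldType} {n d : nat} (X : 'M[F]_(n, d)).

Definition ols : 'M[F]_(d, n) := invmx (X^T *m X) *m X^T.

Lemma ols_scaled_gram k : k != 0 -> k *: (X^T *m X) \in unitmx ->
  k *: (invmx (k *: (X^T *m X)) *m X^T) = ols.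
Proof.
by move=> k0 Xunit; rewrite invmxZ// -scalemxAl scalerA divff// scale1r.
Qed.

Hypothesis Xunit : X^T *m X \in unitmx.

Lemma mul_ols : ols *m X = 1%:M.
Proof. by rewrite /ols -mulmxA mulVmx. Qed.

Lemma mul_ols_trmx : ols *m ols^T = invmx (X^T *m X).
Proof.
by rewrite {2}/ols trmx_mul trmxK trmx_inv trmx_mul trmxK mulmxA mul_ols mul1mx.
Qed.

End OrdinaryLeastSquares.

Section MinimaxRisk.
Context {R : realType} {d n : nat}.
Variables (sigma r lambda : R) (X : 'M[R]_(n, d)) (U : 'M[R]_d).
Variables (e g : 'rV[R]_d).
Hypotheses (sigma0 : sigma != 0) (r0 : 0 < r) (lambda0 : 0 < lambda).
Hypotheses (UtU : U^T *m U = 1%:M) (gram : X^T *m X = spectral_mx U g).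
Hypotheses (e0 : forall i, 0 < e 0 i) (g0 : forall i, 0 < g 0 i).

Notation S := (spectral_mx U e).
Notation noise i := (sigma ^+ 2 / g 0 i).
Notation soft i := (pos (e 0 i - lambda)).

Lemma noise_ge0 i : 0 <= noise i.
Proof. by rewrite divr_ge0 ?sqr_ge0// ltW. Qed.

Definition gain (A : 'M[R]_(d, n)) i : R := (U^T *m (S *m A *m X) *m U) i i.

Lemma bias_eigenvector_ge A i :
  r ^+ 2 * (gain A i - e 0 i) ^+ 2 <=
  sumsq ((S *m A *m X - S) *m (r *: col i U)).
Proof.
rewrite -scalemxAr sumsqZ ler_wpM2l ?sqr_ge0//.
have <- : (U^T *m (S *m A *m X - S) *m U) i i = gain A i - e 0 i.
  rewrite mulmxBr mulmxBl conj_spectral_mx// [LHS]mxE [X in _ + X]mxE.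
  by rewrite [X in _ - X]mxE eqxx.
exact: sqr_conj_diag_le_sumsq.
Qed.

Lemma variance_ge A : \sum_i gain A i ^+ 2 / g 0 i <= frobsq (S *m A).
Proof.
have YY : (X *m U)^T *m (X *m U) = diag_mx g.
  by rewrite trmx_mul -mulmxA (mulmxA X^T) gram mulmxA conj_spectral_mx.
apply: le_trans (bessel_mx _ g0 YY); apply: ler_sum => i _.
rewrite ler_wpM2r ?invr_ge0 ?(ltW (g0 i))//.
by rewrite col_mul mulmxA; exact: sqr_conj_diag_le_sumsq.
Qed.

Lemma average_risk_le_max_risk (tau2 : 'I_d -> R) A :
  (forall i, 0 <= tau2 i) -> \sum_i tau2 i = r ^+ 2 ->
  ((\sum_i (tau2 i * (gain A i - e 0 i) ^+ 2 + noise i * gain A i ^+ 2))%:E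
   <= max_risk sigma r X S A)%E.
Proof.
move=> tau0 tauS; have r20 : 0 < r ^+ 2 by rewrite exprn_gt0.
pose V := sigma ^+ 2 * \sum_i gain A i ^+ 2 / g 0 i.
have weights1 : \sum_i tau2 i / r ^+ 2 = 1.
  by rewrite -mulr_suml tauS divff// gt_eqF.
have -> : \sum_i (tau2 i * (gain A i - e 0 i) ^+ 2 + noise i * gain A i ^+ 2) =
    \sum_i tau2 i / r ^+ 2 * (r ^+ 2 * (gain A i - e 0 i) ^+ 2 + V).
  under [RHS]eq_bigr do rewrite mulrDr mulrA divfK ?gt_eqF//.
  rewrite !big_split/= -[in RHS]mulr_suml weights1 mul1r /V mulr_sumr.
  by congr (_ + _); apply: eq_bigr => i _; ring.
apply: convex_combination_lee => // i; first by rewrite divr_ge0// ltW.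
apply: (@le_trans _ _ (lin_risk sigma X S A (r *: col i U))).
  rewrite lin_riskE// lee_fin lerD ?bias_eigenvector_ge//.
  by rewrite ler_wpM2l ?sqr_ge0// variance_ge.
apply: ereal_sup_ubound; exists (r *: col i U) => //=.
by rewrite l2norm_le ?(ltW r0)// sumsqZ sumsq_col_orthogonal// mulr1.
Qed.

Definition shrinkage : 'rV[R]_d := \row_i pos (1 - lambda / e 0 i).

Definition minimax_value : R := \sum_i noise i * (e 0 i ^+ 2 * shrinkage 0 i).

Lemma mul_shrinkage i : e 0 i * shrinkage 0 i = soft i.
Proof. by rewrite mxE mul_pos_1Bdiv. Qed.

Lemma sqr_mul_shrinkage i : e 0 i ^+ 2 * shrinkage 0 i = e 0 i * soft i.
Proof. by rewrite expr2 -mulrA mul_shrinkage. Qed.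

Lemma lin_risk_spectral_ols (a : 'rV[R]_d) beta :
  lin_risk sigma X S (spectral_mx U a *m ols X) beta =
  (\sum_i (e 0 i * a 0 i - e 0 i) ^+ 2 * (U^T *m beta) i 0 ^+ 2 +
   sigma ^+ 2 * \sum_i (e 0 i * a 0 i) ^+ 2 / g 0 i)%:E.
Proof.
have g_neq0 i : g 0 i != 0 by rewrite gt_eqF.
have gram_unit : X^T *m X \in unitmx by rewrite gram unitmx_spectral.
rewrite lin_riskE// (mulmxA S) mul_spectral_mx// -(mulmxA _ (ols X)) mul_ols//.
rewrite mulmx1 spectral_mxB sumsq_spectral_mx//; congr (_ + _ * _)%:E.
  by apply: eq_bigr => i _; rewrite !mxE.
rewrite /frobsq trmx_mul tr_spectral_mx mulmxA -(mulmxA _ (ols X)).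
rewrite mul_ols_trmx// gram invmx_spectral// !mul_spectral_mx//.
by rewrite mxtrace_spectral//; apply: eq_bigr => i _; rewrite !mxE mulrAC expr2.
Qed.

Hypothesis water_filling :
  \sum_i noise i * pos (e 0 i / lambda - 1) = r ^+ 2.

Lemma minimax_lower_bound A : (minimax_value%:E <= max_risk sigma r X S A)%E.
Proof.
pose tau2 i := noise i * pos (e 0 i / lambda - 1).
have tau2_ge0 i : 0 <= tau2 i by rewrite mulr_ge0 ?noise_ge0 ?pos_ge0.
apply: le_trans (average_risk_le_max_risk A tau2_ge0 water_filling).
rewrite lee_fin; apply: ler_sum => i _; rewrite sqr_mul_shrinkage.
rewrite /tau2 -(mulrA _ (pos _)) -mulrDr.
by rewrite ler_wpM2l ?noise_ge0// soft_threshold_min.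
Qed.

Lemma minimax_valueE :
  minimax_value = lambda ^+ 2 * r ^+ 2 +
                  sigma ^+ 2 * \sum_i (e 0 i * shrinkage 0 i) ^+ 2 / g 0 i.
Proof.
rewrite -water_filling !mulr_sumr -big_split/=; apply: eq_bigr => i _.
rewrite sqr_mul_shrinkage mul_shrinkage.
by rewrite -soft_threshold_balance -(mul_pos_divB1 _ lambda0); ring.
Qed.

Lemma minimax_upper_bound :
  (max_risk sigma r X S (spectral_mx U shrinkage *m ols X) <=
   minimax_value%:E)%E.
Proof.
apply: ge_ereal_sup => _ [beta /= beta_r <-].
rewrite lin_risk_spectral_ols lee_fin minimax_valueE lerD2r.
apply: (@le_trans _ _ (lambda ^+ 2 * sumsq (U^T *m beta))).
  rewrite mulr_sumr; apply: ler_sum => i _; rewrite ler_wpM2r ?sqr_ge0//.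
  by rewrite mul_shrinkage sqr_pos_subr_le// ltW.
by rewrite sumsq_rotate// ler_wpM2l ?sqr_ge0// -l2norm_le// ltW.
Qed.

Lemma max_risk_shrinkage :
  max_risk sigma r X S (spectral_mx U shrinkage *m ols X) = minimax_value%:E.
Proof.
by apply/eqP; rewrite eq_le minimax_upper_bound minimax_lower_bound.
Qed.

End MinimaxRisk.

Theorem theorem1 (R : realType) (d nS : nat) (sigma r : R)
  (XS : 'M[R]_(nS, d)) (SigmaT ST12 U : 'M[R]_d) (t s : 'rV[R]_d) (lambda : R) :
  (0 < d)%N -> (0 < nS)%N -> 0 < sigma -> 0 < r ->
  let SigmaS := nS%:R^-1 *: (XS^T *m XS) in
  SigmaS \in unitmx ->
  (* Sigma_T positive definite *)
  SigmaT^T = SigmaT ->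
  (forall x : 'cV[R]_d, x != 0 -> 0 < (x^T *m SigmaT *m x) 0 0) ->
  (* ST12 = Sigma_T^{1/2}, the positive semidefinite square root *)
  ST12^T = ST12 ->
  (forall x : 'cV[R]_d, 0 <= (x^T *m ST12 *m x) 0 0) ->
  ST12 *m ST12 = SigmaT ->
  (* common orthogonal diagonalization *)
  U^T *m U = 1%:M -> U *m U^T = 1%:M ->
  (forall i, 0 < t 0 i) -> (forall i, 0 < s 0 i) ->
  SigmaT = U *m diag_mx t *m U^T ->
  SigmaS = U *m diag_mx s *m U^T ->
  (* lambda = lambda(r) *)
  0 < lambda ->
  sigma ^+ 2 / nS%:R * \sum_(i < d) (s 0 i)^-1 * pos (Num.sqrt (t 0 i) / lambda - 1)
    = r ^+ 2 ->
  let value := \sum_(i < d) sigma ^+ 2 / nS%:R * (t 0 i / s 0 i)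
                 * pos (1 - lambda / Num.sqrt (t 0 i)) in
  let A_SS := nS%:R^-1 *: (invmx SigmaS *m XS^T) in
  let A_MM := invmx ST12 *m U
                *m diag_mx (\row_i pos (1 - lambda / Num.sqrt (t 0 i)))
                *m U^T *m ST12 *m A_SS in
  (forall A : 'M[R]_(d, nS), (value%:E <= max_risk sigma r XS ST12 A)%E) /\
  max_risk sigma r XS ST12 A_MM = value%:E.
Proof.
move=> _ nS0 sigma0 r0 SigmaS SigmaS_unit _ _ ST12T ST12_psd ST12_sqr UtU _.
move=> t0 s0 SigmaTE SigmaSE lambda0 budget value A_SS A_MM.
have sigma_neq0 := lt0r_neq0 sigma0.
have nS_neq0 : nS%:R != 0 :> R by rewrite pnatr_eq0 -lt0n.
pose e : 'rV[R]_d := \row_i Num.sqrt (t 0 i); pose g := nS%:R *: s.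
have e0 i : 0 < e 0 i by rewrite mxE sqrtr_gt0.
have g0 i : 0 < g 0 i by rewrite mxE mulr_gt0 ?ltr0n.
have ST12E : ST12 = spectral_mx U e.
  by apply: psdmx_sqrt_spectral => //; rewrite ST12_sqr.
have gram : XS^T *m XS = spectral_mx U g.
  by rewrite -spectral_mxZ /spectral_mx -SigmaSE scalerA divff// scale1r.
have water_filling :
    \sum_i sigma ^+ 2 / g 0 i * pos (e 0 i / lambda - 1) = r ^+ 2.
  rewrite -budget mulr_sumr; apply: eq_bigr => i _.
  by rewrite !mxE invfM !mulrA.
have valueE : value = minimax_value sigma lambda e g.
  by apply: eq_bigr => i _; rewrite !mxE invfM sqr_sqrtr ?ltW//; ring.
have shrinkageE :
    \row_i pos (1 - lambda / Num.sqrt (t 0 i)) = shrinkage lambda e.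
  by apply/rowP => i; rewrite !mxE.
have A_MME : A_MM = spectral_mx U (shrinkage lambda e) *m ols XS.
  rewrite -(invmx_conj_spectral UtU (a := e)) => [|i]; last by rewrite gt_eqF.
  by rewrite /A_MM /A_SS ols_scaled_gram ?invr_eq0// ST12E shrinkageE.
rewrite valueE A_MME ST12E; split=> [A|]; first exact: minimax_lower_bound.
exact: max_risk_shrinkage.
Qed.
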